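(* Let $\Pi X.\,s\,[\exists\vec{x}.\varphi]$ be an existentially constrained term and $p\in\mathrm{Pos}(s)$. Let $\rho,\rho'$ be renamed variants of the same left-linear constrained rewrite rule with $\mathrm{Var}(\rho)\cap\mathrm{Var}(s,\varphi)=\emptyset$ and $\mathrm{Var}(\rho')\cap\mathrm{Var}(s,\varphi)=\emptyset$. If $\Pi X.s[\exists\vec{x}.\varphi]\to^p_{\rho}\Pi Y.t[\exists\vec{y}.\psi]$ and $\Pi X.s[\exists\vec{x}.\varphi]\to^p_{\rho'}\Pi Y'.t'[\exists\vec{y}'.\psi']$, then $\Pi Y.t[\exists\vec{y}.\psi]\sim\Pi Y'.t'[\exists\vec{y}'.\psi']$.
   Context: Fix a many-sorted signature whose sorts are partitioned into theory sorts and term sorts and whose function symbols are partitioned into theory symbols (all argument and result sorts are theory sorts) and term symbols; there is a theory sort $\mathsf{Bool}$. $\mathrm{Var}(t_1,\dots,t_n)$ is the set of variables in the $t_i$; $\mathrm{Pos}(s)$, $s|_p$, $s[u]_p$ as usual. A fixed model $\mathcal{M}$ interprets theory sorts by nonempty sets and theory symbols by functions, with $\mathsf{Bool}=\{\mathsf{true},\mathsf{false}\}$ and standard connectives and equalities; every element of every interpreted sort is a constant theory symbol, called a value; $\mathrm{Val}$ is the set of values. A logical constraint is a $\mathsf{Bool}$-sorted term of theory symbols and variables; $\models_{\mathcal{M},\xi}\varphi$ (valuation $\xi$) and $\models_{\mathcal{M}}\varphi$ (all valuations) as usual. Substitutions are sort-preserving, $\mathrm{Dom}(\sigma)=\{x\mid\sigma(x)\ne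 x\}$, $\sigma$ is $X$-valued if $\sigma(X)\subseteq\mathrm{Val}$; a renaming is a bijective variable-to-variable substitution. Existential constraint $\exists\vec x.\varphi$: $\{\vec x\}\subseteq\mathrm{Var}(\varphi)$, $\mathrm{FVar}=\mathrm{Var}(\varphi)\setminus\{\vec x\}$; $\models_{\mathcal{M},\xi}\exists\vec x.\varphi$ iff some values $\vec v$ give $\models_{\mathcal{M},\xi}\varphi\{\vec x\mapsto\vec v\}$; valid/satisfiable: for all/some $\xi$. $\sigma\models_{\mathcal{M}}\exists\vec x.\varphi$ means $\sigma(\mathrm{FVar}(\exists\vec x.\varphi))\subseteq\mathrm{Val}$ and $\models_{\mathcal{M}}(\exists\vec x.\varphi)\sigma$. An existentially constrained term $\Pi X.s[\exists\vec x.\varphi]$ requires $\mathrm{FVar}(\exists\vec x.\varphi)\subseteq X\subseteq\mathrm{Var}(s)$ and $\{\vec x\}\cap\mathrm{Var}(s)=\emptyset$; satisfiable if its constraint is. Equivalence: $\Pi X.s[\exists\vec x.\varphi]\sim\Pi Y.t[\exists\vec y.\psi]$ iff for every $X$-valued $\sigma$ with $\sigma\models_{\mathcal{M}}\exists\vec x.\varphi$ there is a $Y$-valued $\gamma$ with $\gamma\models_{\mathcal{M}}\exists\vec y.\psi$ and $s\sigma=t\gamma$, and vice versa. A constrained rewrite rule $\rho:\Pi Z.\ell\to r[\pi]$: $\ell,r$ terms of the same sort, $\pi$ a logical constraint, $(\mathrm{Var}(r)\setminus\mathrm{Var}(\ell))\cup\mathrm{Var}(\pi)\subseteq Z\subseteq\mathrm{Var}(\ell,r,\pi)=\mathrm{Var}(\rho)$;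 left-linear if $\ell$ is linear; $\mathrm{ExVar}(\rho)=\mathrm{Var}(r)\setminus\mathrm{Var}(\ell)$. A renamed variant of $\rho$ is $\Pi\delta(Z).\ell\delta\to r\delta[\pi\delta]$ for a renaming $\delta$. Most general rewrite step: for satisfiable $\Pi X.s[\exists\vec x.\varphi]$ and left-linear $\rho$ with $\mathrm{Var}(\rho)\cap\mathrm{Var}(s,\varphi)=\emptyset$, if $p\in\mathrm{Pos}(s)$ and $\gamma$ satisfy $\mathrm{Dom}(\gamma)=\mathrm{Var}(\ell)$, $s|_p=\ell\gamma$, $\gamma(x)\in\mathrm{Val}\cup X$ for all $x\in\mathrm{Var}(\ell)\cap Z$, and $\models_{\mathcal{M}}(\exists\vec x.\varphi)\Rightarrow(\exists\vec z.\pi\gamma)$ with $\{\vec z\}=\mathrm{Var}(\pi)\setminus\mathrm{Var}(\ell)$, then $\Pi X.s[\exists\vec x.\varphi]\to^p_\rho\Pi Y.t[\exists\vec y.\psi]$ with $t=s[r\gamma]_p$, $\psi=\varphi\land\pi\gamma$, $\{\vec y\}=\mathrm{Var}(\psi)\setminus\mathrm{Var}(t)$, $Y=\mathrm{ExVar}(\rho)\cup(X\cap\mathrm{Var}(t))$. *)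

(* Defs.v *)
From mathcomp Require Import all_boot.
From mathcomp Require Import finmap.

Set Implicit Arguments.
Unset Strict Implicit.
Unset Printing Implicit Defensive.

Local Open Scope fset_scope.

(* A many-sorted signature together with its sorted variables.  The term sorts
   (resp. term symbols) are the sorts (resp. symbols) that do not satisfy
   [theory_sort] (resp. [theory_symb]).  Values are constant theory symbols and
   are singled out by the model below. *)
Record signature := Signature {
  sort : eqType;
  symb : Type;
  var : choiceType;
  dom : symb -> seq sort;
  cod : symb -> sort;
  var_sort : var -> sort;
  theory_sort : pred sort;
  theory_symb : pred symb;
  bool_sort : sort;
  not_symb : symb;
  and_symb : symb;
  or_symb : symb;
  imp_symb : symb;
  (* [eq_symb a] is only meaningful when [a] is a theory sort *)
  eq_symb : sort -> symb;
  theory_symb_sorts : forall f, theory_symb f ->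
    theory_sort (cod f) && all theory_sort (dom f);
  bool_sort_theory : theory_sort bool_sort;
  not_symbP : [/\ theory_symb not_symb, dom not_symb = [:: bool_sort]
                & cod not_symb = bool_sort];
  and_symbP : [/\ theory_symb and_symb, dom and_symb = [:: bool_sort; bool_sort]
                & cod and_symb = bool_sort];
  or_symbP : [/\ theory_symb or_symb, dom or_symb = [:: bool_sort; bool_sort]
               & cod or_symb = bool_sort];
  imp_symbP : [/\ theory_symb imp_symb, dom imp_symb = [:: bool_sort; bool_sort]
                & cod imp_symb = bool_sort];
  eq_symbP : forall a, theory_sort a ->
    [/\ theory_symb (eq_symb a), dom (eq_symb a) = [:: a; a]
      & cod (eq_symb a) = bool_sort]
}.

(* Every element of an interpreted sort is itself a constant theory symbol, so
   the carrier of a theory sort [a] is the set of the symbols [v] such that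
   [value v] and [cod v = a].  [interp f] is only meaningful when [f] is a
   theory symbol applied to values of the sorts [dom f]. *)
Record model (S : signature) := Model {
  value : pred (symb S);
  interp : symb S -> seq (symb S) -> symb S;
  bval : bool -> symb S;
  valueP : forall v, value v -> theory_symb v /\ dom v = [::];
  carrier_nonempty : forall a : sort S, theory_sort a ->
    exists v, value v /\ cod v = a;
  interpP : forall f vs, theory_symb f -> all value vs -> map (@cod S) vs = dom f ->
    value (interp f vs) /\ cod (interp f vs) = cod f;
  interp_value : forall v, value v -> interp v [::] = v;
  bvalP : forall b, value (bval b) /\ cod (bval b) = bool_sort S;
  bval_inj : injective bval;
  bval_surj : forall v, value v -> cod v = bool_sort S -> exists b, v = bval b;
  interp_not : forall a, interp (not_symb S) [:: bval a] = bval (~~ a);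
  interp_and : forall a b, interp (and_symb S) [:: bval a; bval b] = bval (a && b);
  interp_or : forall a b, interp (or_symb S) [:: bval a; bval b] = bval (a || b);
  interp_imp : forall a b, interp (imp_symb S) [:: bval a; bval b] = bval (a ==> b);
  interp_eq : forall u v, value u -> value v -> cod u = cod v ->
    interp (eq_symb (cod u)) [:: u; v] = bval true <-> u = v
}.

Section Terms.
Variable S : signature.

Inductive term :=
  | TVar of var S
  | TFun of symb S & seq term.

Definition term_sort (t : term) : sort S :=
  match t with TVar x => var_sort x | TFun f _ => cod f end.

Fixpoint well_sorted (t : term) : bool :=
  match t with
  | TVar _ => true
  | TFun f ts => all well_sorted ts && (map term_sort ts == dom f)
  end.

Fixpoint theory_term (t : term) : bool :=
  match t with
  | TVar _ => true
  | TFun f ts => theory_symb f && all theory_term ts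
  end.

Definition logical_constraint (t : term) : bool :=
  [&& well_sorted t, term_sort t == bool_sort S & theory_term t].

(* variable occurrences, with repetitions *)
Fixpoint var_occs (t : term) : seq (var S) :=
  match t with
  | TVar x => [:: x]
  | TFun _ ts => flatten (map var_occs ts)
  end.

Definition Var (t : term) : {fset var S} := [fset x in var_occs t].

Definition linear (t : term) : bool := uniq (var_occs t).

(* Positions list argument indices, counted from 0. *)
Fixpoint subterm (t : term) (p : seq nat) : option term :=
  match p with
  | [::] => Some t
  | i :: q =>
      match t with
      | TVar _ => None
      | TFun _ ts => if onth ts i is Some u then subterm u q else None
      end
  end.

Definition Pos (t : term) : {pred seq nat} := [pred p | isSome (subterm t p)].

(* [replace t p u] is t[u]_p when [p \in Pos t] *)
Fixpoint replace (t : term) (p : seq nat) (u : term) : term :=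
  match p with
  | [::] => u
  | i :: q =>
      match t with
      | TVar _ => t
      | TFun f ts =>
          if onth ts i is Some v then TFun f (set_nth v ts i (replace v q u))
          else t
      end
  end.

Fixpoint subst (s : var S -> term) (t : term) : term :=
  match t with
  | TVar x => s x
  | TFun f ts => TFun f (map (subst s) ts)
  end.

Definition is_subst (s : var S -> term) : Prop :=
  forall x, well_sorted (s x) /\ term_sort (s x) = var_sort x.

Definition is_renaming (d : var S -> var S) : Prop :=
  bijective d /\ is_subst (fun x => TVar (d x)).

Definition rename (d : var S -> var S) : term -> term :=
  subst (fun x => TVar (d x)).

(* The existential constraint which binds [ex_vars] in [ex_body].  Only the set
   of bound variables matters below, so repetitions are not excluded. *)
Record exconstr := ExConstr {
  ex_vars : seq (var S);
  ex_body : term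
}.

Definition FVar (e : exconstr) : {fset var S} :=
  Var (ex_body e) `\` [fset x in ex_vars e].

Definition wf_exconstr (e : exconstr) : Prop :=
  logical_constraint (ex_body e) /\ {subset ex_vars e <= Var (ex_body e)}.

(* Application of a substitution to the free variables; there is no renaming of
   the bound variables, it is only used for substitutions that map all the free
   variables to values, where no capture can occur. *)
Definition ex_subst (s : var S -> term) (e : exconstr) : exconstr :=
  ExConstr (ex_vars e)
    (subst (fun x => if x \in ex_vars e then TVar x else s x) (ex_body e)).

Record ecterm := ECTerm {
  ec_vars : {fset var S};
  ec_term : term;
  ec_constr : exconstr
}.

Definition wf_ecterm (c : ecterm) : Prop :=
  [/\ well_sorted (ec_term c), wf_exconstr (ec_constr c),
      FVar (ec_constr c) `<=` ec_vars c, ec_vars c `<=` Var (ec_term c)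
    & [disjoint [fset x in ex_vars (ec_constr c)] & Var (ec_term c)]].

Record rule := Rule {
  r_vars : {fset var S};
  r_lhs : term;
  r_rhs : term;
  r_constr : term
}.

Definition rule_Var (rho : rule) : {fset var S} :=
  Var (r_lhs rho) `|` Var (r_rhs rho) `|` Var (r_constr rho).

Definition ExVar (rho : rule) : {fset var S} :=
  Var (r_rhs rho) `\` Var (r_lhs rho).

Definition wf_rule (rho : rule) : Prop :=
  [/\ well_sorted (r_lhs rho) && well_sorted (r_rhs rho),
      term_sort (r_lhs rho) = term_sort (r_rhs rho),
      logical_constraint (r_constr rho),
      ExVar rho `|` Var (r_constr rho) `<=` r_vars rho
    & r_vars rho `<=` rule_Var rho].

Definition left_linear (rho : rule) : bool := linear (r_lhs rho).

Definition rename_rule (d : var S -> var S) (rho : rule) : rule :=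
  Rule [fset d x | x in r_vars rho] (rename d (r_lhs rho))
       (rename d (r_rhs rho)) (rename d (r_constr rho)).

Definition renamed_variant (rho rho0 : rule) : Prop :=
  exists2 d, is_renaming d & rho = rename_rule d rho0.

End Terms.

Arguments TVar {S} _.

Section Semantics.
Variables (S : signature) (M : model S).

Definition is_val (t : term S) : bool :=
  if t is TFun v [::] then value M v else false.

Definition valuation (xi : var S -> symb S) : Prop :=
  forall x, theory_sort (var_sort x) -> value M (xi x) /\ cod (xi x) = var_sort x.

Fixpoint eval (xi : var S -> symb S) (t : term S) : symb S :=
  match t with
  | TVar x => xi x
  | TFun f ts => interp M f (map (eval xi) ts)
  end.

Definition holds (xi : var S -> symb S) (t : term S) : Prop :=
  eval xi t = bval M true.

(* the substitution that maps each [x] in [xs] to the value [v x] *)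
Definition val_subst (xs : seq (var S)) (v : var S -> symb S) : var S -> term S :=
  fun x => if x \in xs then TFun (v x) [::] else TVar x.

Definition ex_holds (xi : var S -> symb S) (e : exconstr S) : Prop :=
  exists v : var S -> symb S,
    (forall x, x \in ex_vars e -> value M (v x) /\ cod (v x) = var_sort x) /\
    holds xi (subst (val_subst (ex_vars e) v) (ex_body e)).

Definition ex_valid (e : exconstr S) : Prop :=
  forall xi, valuation xi -> ex_holds xi e.

Definition ex_satisfiable (e : exconstr S) : Prop :=
  exists2 xi, valuation xi & ex_holds xi e.

Definition valued (X : {fset var S}) (s : var S -> term S) : Prop :=
  forall x, x \in X -> is_val (s x).

Definition respects (s : var S -> term S) (e : exconstr S) : Prop :=
  valued (FVar e) s /\ ex_valid (ex_subst s e).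

Definition ec_covered (c c' : ecterm S) : Prop :=
  forall s, is_subst s -> valued (ec_vars c) s -> respects s (ec_constr c) ->
  exists g, [/\ is_subst g, valued (ec_vars c') g, respects g (ec_constr c')
              & subst s (ec_term c) = subst g (ec_term c')].

Definition ec_equiv (c c' : ecterm S) : Prop :=
  ec_covered c c' /\ ec_covered c' c.

Definition mg_redex (rho : rule S) (p : seq nat) (g : var S -> term S)
    (c : ecterm S) : Prop :=
  [/\ is_subst g /\ (forall x, g x <> TVar x <-> x \in Var (r_lhs rho)),
      p \in Pos (ec_term c),
      subterm (ec_term c) p = Some (subst g (r_lhs rho)),
      forall x, x \in Var (r_lhs rho) `&` r_vars rho ->
        is_val (g x) \/ (exists2 y, y \in ec_vars c & g x = TVar y)
    & forall xi, valuation xi -> ex_holds xi (ec_constr c) ->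
        ex_holds xi
          (ExConstr (enum_fset (Var (r_constr rho) `\` Var (r_lhs rho)))
                    (subst g (r_constr rho)))].

(* The tuple of bound variables of the result is only determined up to order,
   hence the [=i]. *)
Definition mg_result (rho : rule S) (p : seq nat) (g : var S -> term S)
    (c c' : ecterm S) : Prop :=
  [/\ ec_term c' = replace (ec_term c) p (subst g (r_rhs rho)),
      ex_body (ec_constr c') =
        TFun (and_symb S) [:: ex_body (ec_constr c); subst g (r_constr rho)],
      ex_vars (ec_constr c') =i
        Var (ex_body (ec_constr c')) `\` Var (ec_term c')
    & ec_vars c' = ExVar rho `|` (ec_vars c `&` Var (ec_term c'))].

(* most general rewrite step from [c] to [c'] at position [p] with [rho] *)
Definition mg_step (rho : rule S) (p : seq nat) (c c' : ecterm S) : Prop :=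
  [/\ wf_ecterm c /\ ex_satisfiable (ec_constr c),
      wf_rule rho /\ left_linear rho,
      [disjoint rule_Var rho & Var (ec_term c) `|` Var (ex_body (ec_constr c))]
    & exists2 g, mg_redex rho p g c & mg_result rho p g c c'].

End Semantics.

(* Main.v *)
Require Import Defs.
From Stdlib Require List.
From mathcomp Require Import all_boot.
From mathcomp Require Import finmap.

Local Open Scope fset_scope.

(** Two renamed variants of a rule differ by a bijection [e] of the variables.
    Left-hand sides matching the same subterm force the two matching
    substitutions to agree along [e], so that the two results differ only by
    renaming, along [e], the variables of the rules that do not occur in the
    left-hand sides; these are fresh for the rewritten term.  Precomposing a
    substitution with that renaming then witnesses the equivalence. *)

(** * Substitutions, variable occurrences and positions in terms *)

Section TermLemmas.
Context {S : signature}.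
Implicit Types (x : var S) (k : symb S) (ts : seq (term S)) (t u : term S).
Implicit Types (f g h : var S -> term S) (d e : var S -> var S).

(** The arguments of [TFun] sit inside a list, so the induction hypothesis has to be stated for its
    members; the inner induction on [ts] keeps the recursive calls guarded. *)
Lemma term_nested_ind (P : term S -> Prop) :
    (forall x, P (TVar x)) ->
    (forall k ts, (forall u, List.In u ts -> P u) -> P (TFun k ts)) ->
  forall t, P t.
Proof.
move=> Pvar Pfun; fix IH 1 => -[x|k ts]; first exact: Pvar.
apply: Pfun; elim: ts => [|t ts IHts] u; first by case.
by case=> [<-|/IHts]; [apply: IH|].
Qed.

Lemma in_Var x t : (x \in Var t) = (x \in var_occs t).
Proof. by rewrite !inE. Qed.

Lemma var_occs_TFun x k ts :
  x \in var_occs (TFun k ts) <-> exists2 u, List.In u ts & x \in var_occs u.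
Proof.
rewrite /=; elim: ts => [|t ts IHts] /=; first by split=> // -[].
rewrite mem_cat; split.
  by case/orP=> [xt|/IHts[u uts xu]]; [exists t; auto | exists u; auto].
by case=> u [<- -> //|uts xu]; apply/orP; right; apply/IHts; exists u.
Qed.

Lemma eq_in_subst t f g : {in Var t, f =1 g} <-> subst f t = subst g t.
Proof.
split.
  elim/term_nested_ind: t => [x|k ts IHts] fg /=.
    by apply: fg; rewrite in_Var /= inE.
  congr TFun; apply: List.map_ext_in => u uts; apply: IHts => // x.
  by rewrite in_Var => xu; apply: fg; rewrite in_Var; apply/var_occs_TFun; exists u.
elim/term_nested_ind: t => [x|k ts IHts] /=.
  by move=> fgx y; rewrite in_Var /= inE => /eqP ->.
case=> fg x; rewrite in_Var => /var_occs_TFun[u uts xu].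
apply: (IHts u uts); last by rewrite in_Var.
exact: (List.ext_in_map fg).
Qed.

Lemma subst_comp f g t : subst f (subst g t) = subst (fun x => subst f (g x)) t.
Proof.
elim/term_nested_ind: t => [x|k ts IHts] //=.
by congr TFun; rewrite -map_comp; apply: List.map_ext_in.
Qed.

Lemma subst_TVar t : subst TVar t = t.
Proof.
elim/term_nested_ind: t => [x|k ts IHts] //=; congr TFun.
by rewrite -[RHS]List.map_id; apply: List.map_ext_in.
Qed.

Lemma subst_id_in t f : {in Var t, f =1 TVar} -> subst f t = t.
Proof. by move/eq_in_subst ->; apply: subst_TVar. Qed.

Lemma in_Var_subst x f t :
  x \in Var (subst f t) <-> exists2 y, y \in Var t & x \in Var (f y).
Proof.
rewrite in_Var; elim/term_nested_ind: t => [y|k ts IHts].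
  split=> [xy|[z]]; first by exists y; rewrite in_Var //= inE.
  by rewrite !in_Var /= inE => /eqP ->.
split.
  case/var_occs_TFun=> _ /List.in_map_iff[u [<- uts]] /(IHts u uts)[y yu xy].
  by exists y => //; move: yu; rewrite !in_Var => yu; apply/var_occs_TFun; exists u.
case=> y; rewrite in_Var => /var_occs_TFun[u uts yu] xy.
apply/var_occs_TFun; exists (subst f u).
  exact: (List.in_map (subst f)).
by apply/(IHts u uts); exists y; rewrite // in_Var.
Qed.

Lemma mem_Var_rename d t x : x \in Var t -> d x \in Var (rename d t).
Proof. by move=> xt; apply/in_Var_subst; exists x; rewrite // in_Var /= inE. Qed.

Lemma mem_Var_rename_inj d t x :
  injective d -> (d x \in Var (rename d t)) = (x \in Var t).
Proof.
move=> d_inj; apply/idP/idP; last exact: mem_Var_rename.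
by case/in_Var_subst=> y yt; rewrite in_Var /= inE => /eqP/d_inj ->.
Qed.

Lemma onth_In (ts : seq (term S)) i u : onth ts i = Some u -> List.In u ts.
Proof.
elim: ts i => [|t ts IHts] [|i] //=; first by case=> ->; left.
by move/IHts; right.
Qed.

Lemma Var_subterm t p u : subterm t p = Some u -> {subset Var u <= Var t}.
Proof.
elim: p t => [|i p IHp] [y|k ts] //=; try by case=> <-.
case Ei: (onth ts i) => [v|] // /IHp vu x /vu.
rewrite !in_Var => xv; apply/var_occs_TFun; exists v => //; exact: onth_In Ei.
Qed.

(** The hypothesis excludes positions that arise only below a variable instantiated by [f]; there
    the two sides may differ. *)
Lemma subst_replace f t p u : p \in Pos t ->
  subst f (replace t p u) = replace (subst f t) p (subst f u).
Proof.
rewrite inE; elim: p t => [|i p IHp] [y|k ts] //=.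
have onth_map : onth (map (subst f) ts) i = omap (subst f) (onth ts i).
  by elim: ts i => [|t ts IHts] [|i] //=; rewrite IHts.
rewrite onth_map; case Ei: (onth ts i) => [v|] //= /IHp IHv.
congr TFun; rewrite -IHv.
(* By [Ei] the index is in range, so [set_nth] never pads with its default. *)
elim: ts i Ei {onth_map} => [|t ts IHts] [|i] //= /IHts.
by rewrite /= => ->.
Qed.

End TermLemmas.

(** * Carrying one rewrite result onto the other *)

Section Transport.
Context {S : signature} {M : model S}.
Implicit Types (t u : term S) (c : ecterm S) (rho : rule S) (d e : var S -> var S).

(** The map [e] goes back from [rho] to [rho0] and then on to [rho']; both renamings preserve sorts,
    hence so does [e]. *)
Lemma renamed_variant_inverse {rho rho0 rho' : rule S} :
    renamed_variant rho rho0 -> renamed_variant rho' rho0 ->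
  exists e e', [/\ cancel e e', cancel e' e, forall x, var_sort (e x) = var_sort x
    & [/\ rename e (r_lhs rho) = r_lhs rho', rename e (r_rhs rho) = r_rhs rho'
        & rename e (r_constr rho) = r_constr rho']].
Proof.
case=> d [[di dK diK] d_sort] -> [d' [[di' dK' diK'] d_sort'] ->].
exists (d' \o di), (d \o di'); split=> [x|x|x|]; rewrite /= ?dK ?dK' //.
  have [_ /= ->] := d_sort' (di x).
  by have [_ /=] := d_sort (di x); rewrite diK.
by split; rewrite /rename subst_comp /=; apply/eq_in_subst => x _ /=; rewrite dK.
Qed.

(** The bijection [e] may move variables of the rewritten term, so it is cut down to the rule
    variables that matching leaves in place. The resulting map need not be injective. *)
Definition transport e rho : var S -> var S :=
  fun x => if x \in rule_Var rho `\` Var (r_lhs rho) then e x else x.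

Lemma transport_sort e rho : (forall x, var_sort (e x) = var_sort x) ->
  forall x, var_sort (transport e rho x) = var_sort x.
Proof. by move=> e_sort x; rewrite /transport; case: ifP. Qed.

Lemma transport_id rho (V : {fset var S}) e x :
  [disjoint rule_Var rho & V] -> x \in V -> transport e rho x = x.
Proof.
move=> dis xV; rewrite /transport inE.
by rewrite (contraTF (fdisjointP dis x)) ?andbF // xV.
Qed.

Lemma rename_transport_id {rho} {V : {fset var S}} {e t} :
    [disjoint rule_Var rho & V] -> {subset Var t <= V} ->
  rename (transport e rho) t = t.
Proof.
move=> dis tV; apply: subst_id_in => x /tV xV.
by rewrite (transport_id _ _ _ _ dis xV).
Qed.

(** On variables of the left-hand side, matching the same subterm gives [g x = g' (e x)], whose
    variables lie in [V] and stay fixed. Any other rule variable [x] is outside the domain of [g],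
    and [e x] is outside that of [g'], so both sides are [e x]. *)
Lemma rename_transport_subst rho rho' e p (g g' : var S -> term S) c (V : {fset var S}) :
    injective e -> rename e (r_lhs rho) = r_lhs rho' ->
    [disjoint rule_Var rho & V] -> {subset Var (ec_term c) <= V} ->
    mg_redex M rho p g c -> mg_redex M rho' p g' c ->
  forall u, {subset Var u <= rule_Var rho} ->
    rename (transport e rho) (subst g u) = subst g' (rename e u).
Proof.
move=> e_inj el dis cV [[_ g_dom] _ gl _ _] [[_ g'_dom] _ gl' _ _] u u_rho.
have gg' : {in Var (r_lhs rho), forall x, g x = g' (e x)}.
  apply/eq_in_subst; move: gl'; rewrite gl -el => -[->].
  by rewrite /rename subst_comp.
(* Equality of terms is not decidable here, so [h x = TVar x] is read off from the shape of
   [h x]. *)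
have off_dom h (A : {fset var S}) x :
    (h x <> TVar x <-> x \in A) -> x \notin A -> h x = TVar x.
  move=> hA xA; case: (h x) hA => [y|f ts] hA; last by case/negP: xA; apply/hA.
  by have [-> //|/eqP yx] := eqVneq y x; case/negP: xA; apply/hA => -[].
rewrite /rename !subst_comp; apply/eq_in_subst => x xu /=.
have [xl|xl] := boolP (x \in Var (r_lhs rho)).
  rewrite -gg' //; apply: (rename_transport_id dis) => y yx; apply: cV.
  by apply: (Var_subterm _ _ _ gl); apply/in_Var_subst; exists x.
rewrite (off_dom _ _ _ (g_dom x)) // (off_dom _ _ _ (g'_dom (e x))).
  by rewrite /= /transport inE xl u_rho.
by rewrite -el mem_Var_rename_inj.
Qed.

(** Freshness makes the transport fix the original term and constraint; only the instances of the
    right-hand side and of the rule constraint change. *)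
Lemma mg_result_transport {rho rho' e p c c1 c2} {g g' : var S -> term S} :
    injective e -> rename e (r_lhs rho) = r_lhs rho' ->
    rename e (r_rhs rho) = r_rhs rho' -> rename e (r_constr rho) = r_constr rho' ->
    [disjoint rule_Var rho & Var (ec_term c) `|` Var (ex_body (ec_constr c))] ->
    mg_redex M rho p g c -> mg_redex M rho' p g' c ->
    mg_result rho p g c c1 -> mg_result rho' p g' c c2 ->
  rename (transport e rho) (ec_term c1) = ec_term c2 /\
  rename (transport e rho) (ex_body (ec_constr c1)) = ex_body (ec_constr c2).
Proof.
move=> e_inj el er ec dis red red' [-> -> _ _] [-> -> _ _].
have cV : {subset Var (ec_term c) <= Var (ec_term c) `|` Var (ex_body (ec_constr c))}.
  by move=> x; rewrite in_fsetU => ->.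
have phiV : {subset Var (ex_body (ec_constr c))
               <= Var (ec_term c) `|` Var (ex_body (ec_constr c))}.
  by move=> x; rewrite in_fsetU => ->; rewrite orbT.
have transport_subst :=
  rename_transport_subst _ _ _ _ _ _ _ _ e_inj el dis cV red red'.
split.
  have [_ pc _ _ _] := red.
  rewrite /rename subst_replace // -!/(rename _ _) transport_subst ?er.
    by rewrite (rename_transport_id dis cV).
  by move=> x; rewrite !in_fsetU => ->; rewrite orbT.
rewrite /rename /= -!/(rename _ _) transport_subst ?ec.
  by rewrite (rename_transport_id dis phiV).
by move=> x; rewrite !in_fsetU => ->; rewrite orbT.
Qed.

(* No capture can occur: [ec_covered] only concerns substitutions that map the
   free variables of the constraint of [c1] to values, and [d] sends its bound variables to bound variables of [c2]. *)
Lemma ec_covered_rename c1 c2 d d' :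
    (forall x, var_sort (d' x) = var_sort x) ->
    rename d (ec_term c1) = ec_term c2 ->
    rename d (ex_body (ec_constr c1)) = ex_body (ec_constr c2) ->
    rename d' (ec_term c2) = ec_term c1 ->
    rename d' (ex_body (ec_constr c2)) = ex_body (ec_constr c1) ->
    ex_vars (ec_constr c1) =i Var (ex_body (ec_constr c1)) `\` Var (ec_term c1) ->
    ex_vars (ec_constr c2) =i Var (ex_body (ec_constr c2)) `\` Var (ec_term c2) ->
    {in ec_vars c2, forall x, d' x \in ec_vars c1} ->
  ec_covered M c1 c2.
Proof.
case: c1 c2 => [Y t [ys psi]] [Y' t' [ys' psi']] /=.
move=> d'_sort dt dpsi d't d'psi ysE ysE' Y'Y f f_subst fY [fpsi valid].
(* The maps are not assumed to be mutually inverse, but a composite renaming that fixes a term fixes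
   each of its variables. *)
have dK_t : {in Var t, cancel d d'}.
  move=> x xt; suff: @TVar S (d' (d x)) = TVar x by case.
  apply: (proj2 (eq_in_subst t (fun x => TVar (d' (d x))) TVar)) => //.
  by rewrite subst_TVar -[in RHS]d't -dt /rename subst_comp.
have dK_psi : {in Var psi, cancel d d'}.
  move=> x xt; suff: @TVar S (d' (d x)) = TVar x by case.
  apply: (proj2 (eq_in_subst psi (fun x => TVar (d' (d x))) TVar)) => //.
  by rewrite subst_TVar -[in RHS]d'psi -dpsi /rename subst_comp.
have d_t x : x \in Var t -> d x \in Var t'.
  by rewrite -dt; apply: mem_Var_rename.
have d'_t x : x \in Var t' -> d' x \in Var t.
  by rewrite -d't; apply: mem_Var_rename.
have d'_psi x : x \in Var psi' -> d' x \in Var psi.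
  by rewrite -d'psi; apply: mem_Var_rename.
have dK'_psi : {in Var psi', cancel d' d}.
  move=> x; rewrite -dpsi => /in_Var_subst[y ypsi].
  by rewrite in_Var /= inE => /eqP ->; rewrite dK_psi.
(* Being bound means not occurring in the term, and [d] preserves and reflects such occurrences for
   variables of [psi]. *)
have d_ys x : x \in Var psi -> (d x \in ys') = (x \in ys).
  move=> xpsi; rewrite ysE ysE' !in_fsetD xpsi -dpsi mem_Var_rename //.
  rewrite !andbT; congr (~~ _); apply/idP/idP => [/d'_t|/d_t //].
  by rewrite dK_psi.
have d'_ys x : x \in ys' -> d' x \in ys.
  move=> xys; have xpsi : x \in Var psi' by move: xys; rewrite ysE' !inE => /andP[].
  by rewrite -d_ys ?dK'_psi // d'_psi.
exists (fun x => f (d' x)); split=> /=.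
- by move=> x; rewrite -(d'_sort x); apply: f_subst.
- by move=> x /Y'Y/fY.
- split=> [x /=|xi /valid[v /= [vP psi_holds]]].
    rewrite /FVar /= in_fsetD => /andP[xys xpsi]; apply: fpsi.
    rewrite /FVar /= in_fsetD d'_psi // andbT.
    apply: contra xys; rewrite !inE => xys.
    by rewrite -(dK'_psi x xpsi) d_ys // d'_psi.
  (* The values chosen for [ys] are reused for [ys'] through [d']. *)
  exists (fun x => v (d' x)); split=> [x /= /d'_ys/vP|]; first by rewrite d'_sort.
  suff -> : subst (val_subst ys' (fun x => v (d' x)))
      (subst (fun x => if x \in ys' then TVar x else f (d' x)) psi') =
    subst (val_subst ys v) (subst (fun x => if x \in ys then TVar x else f x) psi).
    by [].
  rewrite -dpsi /rename !subst_comp; apply/eq_in_subst => x xpsi /=.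
  rewrite d_ys // dK_psi //; case: ifP => xys.
    by rewrite /= /val_subst d_ys // xys dK_psi.
  (* A free variable is sent to a value, a closed term that both outer substitutions leave
     unchanged. *)
  have: is_val M (f x) by apply: fpsi; rewrite /FVar in_fsetD inE /= xys.
  by case: (f x) => [|k []].
- by rewrite -d't /rename subst_comp.
Qed.

End Transport.

(** The two variants play symmetric roles, so one inclusion suffices: the other follows by
    exchanging them. *)
Lemma mg_step_covered (S : signature) (M : model S) (rho0 rho rho' : rule S)
    (p : seq nat) (c c1 c2 : ecterm S) :
    renamed_variant rho rho0 -> renamed_variant rho' rho0 ->
    mg_step M rho p c c1 -> mg_step M rho' p c c2 ->
  ec_covered M c1 c2.
Proof.
move=> var_rho var_rho' [[wf_c _] _ dis [g red res]] [_ _ dis' [g' red' res']].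
have [e [e' [eK e'K e_sort [el er ec]]]] := renamed_variant_inverse var_rho var_rho'.
have unrename u v : rename e u = v -> rename e' v = u.
  by move=> <-; rewrite /rename subst_comp; apply: subst_id_in => x _ /=; rewrite eK.
have [e'l e'r] := (unrename _ _ el, unrename _ _ er).
have e'_inj : injective e' := can_inj e'K.
have [dt dpsi] := mg_result_transport (can_inj eK) el er ec dis red red' res res'.
have [d't d'psi] :=
  mg_result_transport e'_inj e'l e'r (unrename _ _ ec) dis' red' red res' res.
have [_ _ ysE YE] := res; have [_ _ ysE' YE'] := res'.
have [_ _ _ Xs _] := wf_c.
apply: (ec_covered_rename _ _ _ (transport e' rho') _ dt dpsi d't d'psi) => //.
  by apply: transport_sort => x; rewrite -[in RHS](e'K x) e_sort.
(* Extra variables of [rho'] are sent by [e'] to extra variables of [rho]. The remaining ones occur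
   in the term of [c], so they are fixed because [rho'] is fresh. *)
move=> x; rewrite YE YE' !in_fsetU in_fsetI => /orP[|/andP[xX xt]].
  rewrite in_fsetD => /andP[xl xr]; apply/orP; left.
  rewrite /transport in_fsetD xl !in_fsetU xr orbT /=.
  by rewrite /ExVar in_fsetD -e'l -e'r !mem_Var_rename_inj // xl.
have xV : x \in Var (ec_term c) `|` Var (ex_body (ec_constr c)).
  by rewrite in_fsetU (fsubsetP Xs).
apply/orP; right; rewrite (transport_id _ _ _ _ dis' xV) in_fsetI xX /=.
by rewrite -d't -(transport_id _ _ e' _ dis' xV) mem_Var_rename.
Qed.

Theorem mainTheorem4 (S : signature) (M : model S)
    (X : {fset var S}) (s : term S) (xs : seq (var S)) (phi : term S)
    (p : seq nat) (rho0 rho rho' : rule S)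
    (Y : {fset var S}) (t : term S) (ys : seq (var S)) (psi : term S)
    (Y' : {fset var S}) (t' : term S) (ys' : seq (var S)) (psi' : term S) :
  wf_ecterm (ECTerm X s (ExConstr xs phi)) ->
  p \in Pos s ->
  wf_rule rho0 -> left_linear rho0 ->
  renamed_variant rho rho0 -> renamed_variant rho' rho0 ->
  [disjoint rule_Var rho & Var s `|` Var phi] ->
  [disjoint rule_Var rho' & Var s `|` Var phi] ->
  mg_step M rho p (ECTerm X s (ExConstr xs phi)) (ECTerm Y t (ExConstr ys psi)) ->
  mg_step M rho' p (ECTerm X s (ExConstr xs phi)) (ECTerm Y' t' (ExConstr ys' psi')) ->
  ec_equiv M (ECTerm Y t (ExConstr ys psi)) (ECTerm Y' t' (ExConstr ys' psi')).
Proof.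
move=> _ _ _ _ var_rho var_rho' _ _ step step'.
by split; [apply: mg_step_covered var_rho var_rho' step step'
          |apply: mg_step_covered var_rho' var_rho step' step].
Qed.
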